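(* Let $0<\alpha\le\infty$. Assume that $n\ge2$ and $f\in S_{\mathrm{mono}}^{(n)}(-\alpha,\alpha)$. For every $A\ge0$ in $M_n(\mathbb{R})$ with $\|A\|<\alpha$, $$\lambda(f[A]-f(0)J)\prec_w\lambda(f(A)-f(0)I).$$
   Context: For a real function $f$ on $(-\alpha,\alpha)$ and a real matrix $A=[a_{ij}]$ with all entries in $(-\alpha,\alpha)$, $f[A]:=[f(a_{ij})]$ (entrywise), whereas for Hermitian $A$ with eigenvalues in $(-\alpha,\alpha)$, $f(A)$ denotes the usual functional calculus. $J$ is the $n\times n$ matrix with all entries equal to $1$ and $I$ is the $n\times n$ identity matrix. $\|A\|$ is the operator norm. For real symmetric matrices, $A\ge0$ means positive semidefinite, and $A\ge B$ means $A-B\ge0$. $S_{\mathrm{mono}}^{(n)}(-\alpha,\alpha)$ is the set of real functions $f$ on $(-\alpha,\alpha)$ such that $A\ge B\ge0$ implies $f[A]\ge f[B]$ for all symmetric $A,B\in M_n(\mathbb{R})$ with entries in $(-\alpha,\alpha)$. For a Hermitian $n\times n$ matrix $X$, $\lambda(X)=(\lambda_1(X),\dots,\lambda_n(X))$ is the vector of its eigenvalues in decreasing order (with multiplicity). For real $n$-vectors $\mathbf{a},\mathbf{b}$, the weak majorization $\mathbf{a}\prec_w\mathbf{b}$ means $\sum_{i=1}^ka_{[i]}\le\sum_{i=1}^kb_{[i]}$ for $1\le k\le n$, where $(a_{[1]},\dots,a_{[n]})$ and $(b_{[1]},\dots,b_{[n]})$ are the decreasing rearrangements of the coordinates. *)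

(* Defs.v *)
From HB Require Import structures.
From mathcomp Require Import all_boot all_order all_algebra.
From mathcomp Require Import complex.
From mathcomp Require Import all_classical all_reals all_analysis.

Set Implicit Arguments.
Unset Strict Implicit.
Unset Printing Implicit Defensive.

Import Order.TTheory GRing.Theory Num.Theory.

Local Open Scope classical_set_scope.
Local Open Scope ring_scope.

(* A real function on (-alpha, alpha), with alpha possibly +oo, is represented
   by a total function R -> R; its values off the interval are never used. *)
Definition in_sym_itv (R : realType) (alpha : \bar R) (x : R) : Prop :=
  (- alpha < x%:E)%E /\ (x%:E < alpha)%E.

Definition entries_in (R : realType) (n : nat) (alpha : \bar R)
    (A : 'M[R]_n) : Prop :=
  forall i j, in_sym_itv alpha (A i j).

Definition psdmx (R : realType) (n : nat) (A : 'M[R]_n) : Prop :=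
  A^T = A /\ forall x : 'cV[R]_n, 0 <= (x^T *m A *m x) 0 0.

Definition loewner_ge (R : realType) (n : nat) (A B : 'M[R]_n) : Prop :=
  psdmx (A - B).

(* [map_mx f A] is the entrywise f[A]. *)
Definition S_mono (R : realType) (n : nat) (alpha : \bar R) (f : R -> R) : Prop :=
  forall A B : 'M[R]_n,
    A^T = A -> B^T = B -> entries_in alpha A -> entries_in alpha B ->
    loewner_ge A B -> psdmx B -> loewner_ge (map_mx f A) (map_mx f B).

Definition l2norm (R : realType) (n : nat) (x : 'cV[R]_n) : R :=
  Num.sqrt (\sum_i x i 0 ^+ 2).

Definition opnorm (R : realType) (n : nat) (A : 'M[R]_n) : R :=
  sup [set l2norm (A *m x) | x in [set x : 'cV[R]_n | l2norm x <= 1]].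

Definition complexmx (R : realType) (n : nat) (A : 'M[R]_n) : 'M[R[i]]_n :=
  map_mx (real_complex R) A.

Definition decr_rearrangement (R : realType) (n : nat) (a : 'rV[R]_n) : seq R :=
  sort >=%R [seq a 0 i | i : 'I_n].

(* For Hermitian X the entries of [spectral_diag X] are real
   ([hermitian_spectral_diag_real]), so taking real parts loses nothing. *)
Definition eigval (R : realType) (n : nat) (X : 'M[R[i]]_n) : 'rV[R]_n :=
  \row_i (decr_rearrangement (map_mx (@complex.Re R) (spectral_diag X)))`_i.

(* f(X) = U^-1 diag(f(d)) U, for the library's diagonalization
   X = U^-1 diag(d) U of a Hermitian X by a unitary U ([orthomx_spectralP]);
   the value does not depend on which unitary diagonalization is used. *)
Definition funcalc (R : realType) (n : nat) (f : R -> R) (X : 'M[R[i]]_n) :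
    'M[R[i]]_n :=
  invmx (spectralmx X)
  *m diag_mx (map_mx (fun z : R[i] => (f (complex.Re z))%:C%C) (spectral_diag X))
  *m spectralmx X.

Definition weak_major (R : realType) (n : nat) (a b : 'rV[R]_n) : Prop :=
  forall k : nat, (1 <= k <= n)%N ->
    \sum_(i < k) (decr_rearrangement a)`_i <= \sum_(i < k) (decr_rearrangement b)`_i.

(* Main.v *)
Require Import Defs.
From HB Require Import structures.
From mathcomp Require Import all_boot all_order all_algebra.
From mathcomp Require Import complex.
From mathcomp Require Import all_classical all_reals all_analysis.
From mathcomp Require Import ring lra.

Set Implicit Arguments.
Unset Strict Implicit.
Unset Printing Implicit Defensive.

Import Order.TTheory GRing.Theory Num.Theory.

Local Open Scope ring_scope.

(** Put d for the eigenvalues of A, fix k, and let t be the k-th largest of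
    them. Truncating the spectrum at t gives C = min(A, t), with 0 <= C <= A and
    C <= t I. Monotonicity of f on these pairs gives f[A] - f[C] >= 0 and
    f[C] - f(0) J <= (f(t) - f(0)) I, because f[t I] = f(0) J + (f(t) - f(0)) I.
    So f[A] - f(0) J splits into a part bounded by (f(t) - f(0)) I and a positive
    part, and Ky Fan's inequality [ky_fan_le] bounds the sum of its k largest
    eigenvalues by k (f(t) - f(0)) + tr (f[A] - f[C]).

    The trace only sees diagonal entries. Those of A and C are averages of the
    d_j and of the min(d_j, t), with the same weights w_ij. On [0, alpha) the
    function f is nondecreasing, has nondecreasing increments and is convex
    ([S_mono_incr], [S_mono_slopes]). As c_ii <= t, the increment of f from c_ii
    to a_ii is at most the one of the same length starting at t, which ends at
    the average of the max(d_j, t), and Jensen's inequality applies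
    ([S_mono_jensen_incr]). The weights are doubly stochastic, so summing over i
    leaves tr (f[A] - f[C]) <= sum_j (f(max(d_j, t)) - f(t)). By the choice of t,
    k (f(t) - f(0)) plus this sum is exactly the sum of the k largest values
    f(d_j) - f(0) ([sum_above_threshold]), that is, of the k largest eigenvalues
    of f(A) - f(0) I.

    The spectral theorem is used over the complex numbers. The real and imaginary
    parts p_j, q_j of the rows of the diagonalizing unitary satisfy
    p_j A = d_j p_j, q_j A = d_j q_j and sum_j (p_j^T p_j + q_j^T q_j) = I, and
    this real resolution of the identity replaces a real orthonormal eigenbasis
    throughout. *)

(** * Positive semidefinite matrices *)

Lemma psd_congr (R : realType) (m n : nat) (M : 'M[R]_m) (V : 'M[R]_(m, n)) :
  psdmx M -> psdmx (V^T *m M *m V).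
Proof.
move=> [sM pM]; split; first by rewrite !trmx_mul trmxK sM mulmxA.
by move=> x; have := pM (V *m x); rewrite trmx_mul !mulmxA.
Qed.

Lemma psd_diag (R : realType) (n : nat) (e : 'rV[R]_n) :
  (forall j, 0 <= e 0 j) -> psdmx (diag_mx e).
Proof.
move=> e0; split=> [|x]; first exact: tr_diag_mx.
rewrite mul_mx_diag mxE sumr_ge0 // => j _.
by rewrite !mxE mulrAC -expr2 mulr_ge0 ?sqr_ge0.
Qed.

Lemma psdD (R : realType) (n : nat) (M N : 'M[R]_n) :
  psdmx M -> psdmx N -> psdmx (M + N).
Proof.
move=> [sM pM] [sN pN]; split=> [|x]; first by rewrite linearD /= sM sN.
by rewrite mulmxDr mulmxDl mxE addr_ge0.
Qed.

Lemma psdZ (R : realType) (n : nat) (a : R) (M : 'M[R]_n) :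
  0 <= a -> psdmx M -> psdmx (a *: M).
Proof.
move=> a0 [sM pM]; split=> [|x]; first by rewrite linearZ /= sM.
by rewrite -scalemxAr -scalemxAl mxE mulr_ge0.
Qed.

Lemma psd_ones (R : realType) (n : nat) : psdmx (const_mx 1 : 'M[R]_n).
Proof.
have -> : (const_mx 1 : 'M[R]_n)
    = (const_mx 1 : 'rV[R]_n)^T *m diag_mx (const_mx 1) *m const_mx 1.
  apply/matrixP=> i j; rewrite diag_const_mx mulmx1.
  by rewrite mxE mxE big_ord1 !mxE mulr1.
by apply/psd_congr/psd_diag => j; rewrite mxE.
Qed.

Lemma quad_delta (R : realType) (n : nat) (M : 'M[R]_n) (i j : 'I_n) :
  ((delta_mx i 0 : 'cV[R]_n)^T *m M *m (delta_mx j 0 : 'cV[R]_n)) 0 0 = M i j.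
Proof. by rewrite trmx_delta -rowE -colE !mxE. Qed.

Lemma psd_delta (R : realType) (n : nat) (i : 'I_n) :
  psdmx (delta_mx i i : 'M[R]_n).
Proof.
have -> : delta_mx i i = diag_mx (delta_mx 0 i) :> 'M[R]_n.
  apply/matrixP=> k l; rewrite !mxE eqxx /=.
  case: (eqVneq k l) => [<-|kl]; first by rewrite andbb.
  by case: (k =P i) => [ki|//]; rewrite -ki eq_sym (negPf kl).
by apply: psd_diag => j; rewrite mxE ler0n.
Qed.

Lemma psd_diag_ge0 (R : realType) (n : nat) (M : 'M[R]_n) (i : 'I_n) :
  psdmx M -> 0 <= M i i.
Proof. by move=> [_ /(_ (delta_mx i 0))]; rewrite quad_delta. Qed.

(** The form at e_i + s e_j; s = 1 and s = -1 bound the entry (i, j). *)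
Lemma psd_minor (R : realType) (n : nat) (M : 'M[R]_n) (i j : 'I_n) (s : R) :
  psdmx M -> 0 <= M i i + s * M i j *+ 2 + s ^+ 2 * M j j.
Proof.
move=> [sM /(_ (delta_mx i 0 + s *: delta_mx j 0))].
have mxD (X Y : 'M[R]_1) : (X + Y) 0 0 = X 0 0 + Y 0 0 by rewrite mxE.
have mxZ a (X : 'M[R]_1) : (a *: X) 0 0 = a * X 0 0 by rewrite mxE.
have -> : (delta_mx i 0 + s *: delta_mx j 0)^T
    = (delta_mx i 0)^T + s *: (delta_mx j 0)^T :> 'rV[R]_n.
  by apply/matrixP=> k l; rewrite !mxE.
rewrite !(mulmxDl, mulmxDr).
rewrite -!(scalemxAl, scalemxAr) !(mxD, mxZ) !quad_delta.
have -> : M j i = M i j by rewrite -[in LHS]sM mxE.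
by congr (_ <= _); ring.
Qed.

(** How 0 <= M <= r I with r < alpha puts all entries of M in the interval: the
    diagonal entries are at most r, and the 2 x 2 minors control the others. *)
Lemma psd_entry_le (R : realType) (n : nat) (M : 'M[R]_n) (r : R) :
  psdmx M -> psdmx (r%:M - M) -> forall i j, `|M i j| <= r.
Proof.
move=> pM prM i j.
have dM k : M k k <= r.
  by have := psd_diag_ge0 k prM; rewrite !mxE eqxx mulr1n subr_ge0.
have := psd_minor i j 1 pM; have := psd_minor i j (-1) pM.
have := dM i; have := dM j; rewrite ler_norml => *; apply/andP; split; lra.
Qed.

(** * Scalar properties of entrywise monotone functions *)

Lemma lte_fin_trans (R : realType) (alpha : \bar R) (x y : R) :
  x <= y -> (y%:E < alpha)%E -> (x%:E < alpha)%E.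
Proof. by move=> xy; apply: le_lt_trans; rewrite lee_fin. Qed.

Lemma in_sym_itvP (R : realType) (alpha : \bar R) (r x : R) :
  `|x| <= r -> (r%:E < alpha)%E -> in_sym_itv alpha x.
Proof.
rewrite ler_norml => /andP[lx xr] ra; split; last exact: lte_fin_trans ra.
by rewrite lteNl (lte_fin_trans _ ra) // lerNl.
Qed.

(** Adding b J to the matrix B that is c everywhere except for one diagonal entry
    t changes f[B] by the matrix whose entries are the increment of f from c, except
    for one diagonal entry, the increment from t. Positivity of this change at
    e_0 - e_1, where e_0 marks the exceptional entry, compares the two. *)
Lemma S_mono_incr (R : realType) (alpha : \bar R) (n : nat) (f : R -> R)
    (c t b : R) :
  (2 <= n)%N -> S_mono n alpha f ->
  0 <= c -> c <= t -> 0 <= b -> ((t + b)%:E < alpha)%E ->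
  0 <= f (c + b) - f c <= f (t + b) - f t.
Proof.
move=> n2 hf c0 ct b0 tba.
pose i0 := Ordinal (ltnW n2); pose i1 := Ordinal n2.
pose B : 'M[R]_n := c *: const_mx 1 + (t - c) *: delta_mx i0 i0.
pose A : 'M[R]_n := B + b *: const_mx 1.
have pB : psdmx B.
  by apply: psdD; apply: psdZ; rewrite ?subr_ge0 //; [exact: psd_ones|exact: psd_delta].
have pAB : psdmx (A - B).
  by rewrite addrAC subrr add0r; apply: psdZ => //; exact: psd_ones.
have pA : psdmx A by apply: psdD => //; apply: psdZ => //; exact: psd_ones.
have BE i j : B i j = if (i == i0) && (j == i0) then t else c.
  by rewrite !mxE mulr1; case: ifP => _; rewrite /= ?mulr1 ?mulr0; ring.
have AE i j : A i j = B i j + b by rewrite /A mxE; congr (_ + _); rewrite !mxE mulr1.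
have Bb i j : 0 <= B i j <= t by rewrite BE; case: ifP; lra.
have eB : entries_in alpha B.
  move=> i j; have /andP[l u] := Bb i j; apply: in_sym_itvP tba.
  by rewrite ger0_norm //; lra.
have eA : entries_in alpha A.
  move=> i j; have /andP[l u] := Bb i j; apply: in_sym_itvP tba.
  by rewrite ger0_norm AE; lra.
have P : psdmx (map_mx f A - map_mx f B) by apply: hf => //; [case: pA|case: pB].
have := psd_diag_ge0 i1 P; have := psd_minor i0 i1 (-1) P.
have PE (X Y : 'M[R]_n) i j :
    (map_mx f X - map_mx f Y) i j = f (X i j) - f (Y i j) by rewrite !mxE.
rewrite !PE !AE !BE /=; lra.
Qed.

Lemma S_mono_nondecreasing (R : realType) (alpha : \bar R) (n : nat) (f : R -> R)
    (c t : R) :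
  (2 <= n)%N -> S_mono n alpha f -> 0 <= c -> c <= t -> (t%:E < alpha)%E ->
  f c <= f t.
Proof.
move=> n2 hf c0 ct ta.
have := @S_mono_incr _ alpha n f c c (t - c) n2 hf c0 (lexx _).
by rewrite addrCA subrr addr0 => /(_ ltac:(lra) ta); lra.
Qed.

(** Convexity of f on [0, alpha), with no continuity assumed. Cut [y, z] into N + 1
    steps of length h: each increment there is at least D = f(y + h) - f(y), and
    each increment of length h starting at or before y is at most D. As the length h need
    not divide y - x, one extra step is spent, which costs O(1 / N). *)
Lemma S_mono_slopes (R : realType) (alpha : \bar R) (n : nat) (f : R -> R)
    (x y z : R) :
  (2 <= n)%N -> S_mono n alpha f ->
  0 <= x -> x <= y -> y < z -> (z%:E < alpha)%E ->
  (f y - f x) * (z - y) <= (y - x) * (f z - f y).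
Proof.
move=> n2 hf x0 xy yz za.
have incr c t b := @S_mono_incr _ alpha n f c t b n2 hf.
have iter_ge (w h : R) (N : nat) : 0 <= w -> 0 <= h ->
    ((w + N.+1%:R * h)%:E < alpha)%E ->
    N.+1%:R * (f (w + h) - f w) <= f (w + N.+1%:R * h) - f w.
  move=> w0 h0; elim: N => [|N IH] wa; first by rewrite !mul1r.
  have Nh : 0 <= N.+1%:R * h by rewrite mulr_ge0.
  have E : w + N.+2%:R * h = w + N.+1%:R * h + h.
    by rewrite -[N.+2]addn1 natrD; ring.
  have IH' := IH (lte_fin_trans _ wa).
  have {}IH' := IH' ltac:(by rewrite E lerDl).
  have := incr w (w + N.+1%:R * h) h w0 _ h0; rewrite -E lerDl => /(_ Nh wa).
  have -> : N.+2%:R = N.+1%:R + 1 :> R by rewrite -[N.+2]addn1 natrD.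
  by lra.
have iter_le (w t h : R) (N : nat) : 0 <= w -> 0 <= h -> w + N%:R * h <= t ->
    ((t + h)%:E < alpha)%E ->
    f (w + N.+1%:R * h) - f w <= N.+1%:R * (f (t + h) - f t).
  move=> w0 h0; elim: N => [|N IH] wt ta.
    have := incr w t h w0 _ h0 ta; rewrite !mul1r => H.
    by have := H ltac:(lra); lra.
  have Nh : 0 <= N.+1%:R * h by rewrite mulr_ge0.
  have E : w + N.+2%:R * h = w + N.+1%:R * h + h.
    by rewrite -[N.+2]addn1 natrD; ring.
  have IH' := IH _ ta.
  have {}IH' := IH' ltac:(apply: le_trans wt; rewrite lerD2l ler_wpM2r // ler_nat //).
  have := incr (w + N.+1%:R * h) t h _ wt h0 ta.
  rewrite -E => /(_ ltac:(lra)).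
  have -> : N.+2%:R = N.+1%:R + 1 :> R by rewrite -[N.+2]addn1 natrD.
  by lra.
have fyz : 0 <= f z - f y.
  by rewrite subr_ge0 (S_mono_nondecreasing n2 hf _ _ za) //; lra.
have step (N : nat) :
    (f y - f x) * (z - y) <= (y - x) * (f z - f y) + N.+1%:R^-1 * ((z - y) * (f z - f y)).
  pose h := (z - y) / N.+1%:R.
  have h0 : 0 < h by rewrite divr_gt0 // subr_gt0.
  have Nh : N.+1%:R * h = z - y by rewrite mulrC divfK // pnatr_eq0.
  have yh : y + h <= z by rewrite -lerBrDl -Nh (ler_peMl (ltW h0)) // ler1n.
  have q0 : 0 <= (y - x) / h by rewrite divr_ge0 ?subr_ge0 // ltW.
  have /andP[] := truncn_itv q0; set m := Num.truncn _.
  (* m full steps of length h fit between x and y, and m + 1 steps do not *)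
  rewrite ler_pdivlMr // ltr_pdivrMr // => mh Mh.
  have D1 := iter_ge y h N _ (ltW h0).
  rewrite Nh addrCA subrr addr0 in D1.
  have {}D1 := D1 ltac:(lra) za.
  have D2 := iter_le x y h m x0 (ltW h0) ltac:(lra) (lte_fin_trans yh za).
  have D3 : f y <= f (x + m.+1%:R * h).
    apply: (S_mono_nondecreasing n2 hf); [lra|lra|].
    apply: lte_fin_trans za; apply: le_trans yh.
    have -> : m.+1%:R = m%:R + 1 :> R by rewrite -[m.+1]addn1 natrD.
    by lra.
  set D := f (y + h) - f y in D1 D2.
  have D4 : (f y - f x) * (z - y) <= m.+1%:R * D * (z - y).
    by rewrite ler_wpM2r //; lra.
  apply: le_trans D4 _; rewrite -[in X in X <= _]Nh.
  have -> : m.+1%:R * D * (N.+1%:R * h) = (m.+1%:R * h) * (N.+1%:R * D) by ring.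
  have D5 : m.+1%:R * h <= y - x + h.
    have -> : m.+1%:R = m%:R + 1 :> R by rewrite -[m.+1]addn1 natrD.
    by lra.
  have D6 : m.+1%:R * h * (N.+1%:R * D) <= m.+1%:R * h * (f z - f y).
    by rewrite ler_wpM2l // mulr_ge0 // ltW.
  apply: le_trans D6 _.
  have -> : (y - x) * (f z - f y) + N.+1%:R^-1 * ((z - y) * (f z - f y))
      = (y - x + h) * (f z - f y) by rewrite /h; ring.
  by rewrite ler_wpM2r.
apply/ler_addgt0Pr => e e0.
set P := (z - y) * (f z - f y) in step.
have P0 : 0 <= P by rewrite mulr_ge0 // subr_ge0 ltW.
have Pe : 0 <= P / e by rewrite divr_ge0 // ltW.
have /andP[_] := truncn_itv Pe; set N := Num.truncn _ => /ltW PN.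
apply: le_trans (step N) _; rewrite lerD2l mulrC ler_pdivrMr //.
by rewrite ler_pdivrMr // mulrC in PN.
Qed.

(** The slope is the supremum of the chord slopes to the left of y. There are none
    at y = 0, where slope 0 works because f is nondecreasing. *)
Lemma S_mono_subgradient (R : realType) (alpha : \bar R) (n : nat) (f : R -> R)
    (y : R) :
  (2 <= n)%N -> S_mono n alpha f -> 0 <= y -> (y%:E < alpha)%E ->
  exists s : R, forall x : R, 0 <= x -> (x%:E < alpha)%E ->
    f y + s * (x - y) <= f x.
Proof.
move=> n2 hf y0 ya.
pose S := [set s : R | exists x : R,
  [/\ 0 <= x, x < y & s = (f y - f x) / (y - x)]]%classic.
have [S0|S0] := pselect (S !=set0)%classic; last first.
  exists 0 => x x0 xa; rewrite mul0r addr0.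
  apply: (S_mono_nondecreasing n2 hf) => //; rewrite leNgt; apply/negP => xy.
  by apply: S0; exists ((f y - f x) / (y - x)); exists x.
have ubS x : y < x -> (x%:E < alpha)%E -> ubound S ((f x - f y) / (x - y)).
  move=> yx xa _ [w [w0 wy ->]].
  rewrite ler_pdivrMr ?subr_gt0 // mulrAC ler_pdivlMr ?subr_gt0 //.
  by rewrite [leRHS]mulrC; exact: S_mono_slopes n2 hf w0 (ltW wy) yx xa.
have [z yz za] : exists2 z : R, y < z & (z%:E < alpha)%E.
  case: alpha ya {ubS hf} => [a| |] //; last first.
    by move=> _; exists (y + 1); rewrite ?ltry //; lra.
  by rewrite lte_fin => ya; exists ((y + a) / 2); rewrite ?lte_fin; lra.
have supS : has_sup S by split; [| exists ((f z - f y) / (z - y)); exact: ubS].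
exists (sup S) => x x0 xa; case: (ltgtP x y) => [xy|yx|->].
- have : (f y - f x) / (y - x) <= sup S by apply: ub_le_sup; [case: supS|exists x].
  by rewrite ler_pdivrMr ?subr_gt0 //; lra.
- have : sup S <= (f x - f y) / (x - y) by apply: ge_sup => //; exact: ubS.
  by rewrite ler_pdivlMr ?subr_gt0 //; lra.
- by rewrite subrr mulr0 addr0.
Qed.

(** With a and c the two averages, the increment of f from c to a is moved to start
    at t >= c, where it can only grow. It then ends at the average of the
    max(d_j, t), since min(d, t) + max(d, t) = d + t, and Jensen's inequality
    bounds f there. *)
Lemma S_mono_jensen_incr (R : realType) (alpha : \bar R) (n : nat) (f : R -> R)
    (m : nat) (w d : 'I_m -> R) (t : R) :
  (2 <= n)%N -> S_mono n alpha f ->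
  (forall j, 0 <= w j) -> \sum_j w j = 1 ->
  0 <= t -> (t%:E < alpha)%E -> (forall j, 0 <= d j /\ ((d j)%:E < alpha)%E) ->
  f (\sum_j w j * d j) - f (\sum_j w j * Num.min (d j) t)
    <= \sum_j w j * (f (Num.max (d j) t) - f t).
Proof.
move=> n2 hf w0 w1 t0 ta dP.
set a := \sum_j w j * d j; set c := \sum_j w j * Num.min (d j) t.
have sumwZ r : \sum_j w j * r = r by rewrite -mulr_suml w1 mul1r.
have c0 : 0 <= c.
  by apply: sumr_ge0 => j _; rewrite mulr_ge0 // le_min t0 (dP j).1.
have ct : c <= t.
  by rewrite -[leRHS]sumwZ ler_sum // => j _; rewrite ler_wpM2l // ge_min lexx orbT.
have ca : c <= a by rewrite ler_sum // => j _; rewrite ler_wpM2l // ge_min lexx.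
have maxE : t + (a - c) = \sum_j w j * Num.max (d j) t.
  rewrite -{1}(sumwZ t) -sumrB -big_split; apply: eq_bigr => j _ /=.
  by have := addr_max_min (d j) t => E; rewrite -mulrBr -mulrDr; congr (_ * _); lra.
have maxa j : ((Num.max (d j) t)%:E < alpha)%E.
  by rewrite /Num.max; case: ifP => // _; exact: (dP j).2.
have max0 j : 0 <= Num.max (d j) t by rewrite le_max t0 orbT.
have ya : ((t + (a - c))%:E < alpha)%E.
  pose M := \big[Num.max/t]_j d j.
  have dM j : d j <= M by exact: le_bigmax.
  have tM : t <= M by exact: bigmax_ge_id.
  have Ma : (M%:E < alpha)%E.
    apply: (@big_ind _ (fun z : R => (z%:E < alpha)%E)) => [|x y xa ya|j _].
    - exact: ta.
    - by rewrite /Num.max; case: ifP.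
    - exact: (dP j).2.
  apply: lte_fin_trans Ma; rewrite maxE -[leRHS]sumwZ ler_sum // => j _.
  by rewrite ler_wpM2l // ge_max dM tM.
have y0 : 0 <= t + (a - c) by lra.
have [s sP] := S_mono_subgradient n2 hf y0 ya.
have /andP[_] := @S_mono_incr _ alpha n f c t (a - c) n2 hf c0 ct ltac:(lra) ya.
rewrite addrCA subrr addr0 => /le_trans; apply.
have : \sum_j w j * (f (t + (a - c)) + s * (Num.max (d j) t - (t + (a - c))))
   <= \sum_j w j * f (Num.max (d j) t).
  by rewrite ler_sum // => j _; rewrite ler_wpM2l // sP.
under eq_bigr do rewrite mulrDr mulrCA mulrBr.
rewrite big_split /= -mulr_sumr sumrB !sumwZ -maxE subrr mulr0 addr0.
move=> jensen; under eq_bigr do rewrite mulrBr.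
by rewrite sumrB sumwZ lerD2r.
Qed.

(** * The spectral theorem for real symmetric matrices *)

Lemma ReD (R : realType) (x y : R[i]) :
  complex.Re (x + y) = complex.Re x + complex.Re y.
Proof. by case: x y => [a b] [c d]. Qed.

Lemma ImD (R : realType) (x y : R[i]) :
  complex.Im (x + y) = complex.Im x + complex.Im y.
Proof. by case: x y => [a b] [c d]. Qed.

Lemma Re_sum (R : realType) (I : finType) (F : I -> R[i]) :
  complex.Re (\sum_i F i) = \sum_i complex.Re (F i).
Proof. exact: (big_morph _ (@ReD R) erefl). Qed.

Lemma Im_sum (R : realType) (I : finType) (F : I -> R[i]) :
  complex.Im (\sum_i F i) = \sum_i complex.Im (F i).
Proof. exact: (big_morph _ (@ImD R) erefl). Qed.

Lemma ReMreal (R : realType) (z : R[i]) (a : R) :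
  complex.Re (z * a%:C%C) = complex.Re z * a.
Proof. by case: z => x y /=; rewrite mulr0 subr0. Qed.

Lemma ImMreal (R : realType) (z : R[i]) (a : R) :
  complex.Im (z * a%:C%C) = complex.Im z * a.
Proof. by case: z => x y /=; rewrite mulr0 add0r. Qed.

Lemma complexmx_hermitian (R : realType) (n : nat) (X : 'M[R]_n) :
  X^T = X -> complexmx X \is hermsymmx.
Proof.
move=> sX; apply: realsym_hermsym.
  by apply/is_hermitianmxP; rewrite expr0 scale1r map_mx_id // /complexmx map_trmx sX.
by apply/mxOverP=> i j; rewrite mxE complex_real.
Qed.

(** The real and imaginary parts of row j of the diagonalizing unitary are two real
    solutions v of v X = d_j v for the j-th eigenvalue d_j; one of them may vanish,
    and they need not be orthogonal. *)
Definition eigvec_re (R : realType) (n : nat) (X : 'M[R]_n) : 'M[R]_n :=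
  map_mx (@complex.Re R) (spectralmx (complexmx X)).
Definition eigvec_im (R : realType) (n : nat) (X : 'M[R]_n) : 'M[R]_n :=
  map_mx (@complex.Im R) (spectralmx (complexmx X)).
Definition eigs (R : realType) (n : nat) (X : 'M[R]_n) : 'rV[R]_n :=
  map_mx (@complex.Re R) (spectral_diag (complexmx X)).

Lemma spectral_diag_eigs (R : realType) (n : nat) (X : 'M[R]_n) :
  X^T = X -> spectral_diag (complexmx X) = map_mx (real_complex R) (eigs X).
Proof.
move=> sX; apply/rowP=> j; rewrite !mxE RRe_real //.
have /mxOverP := hermitian_spectral_diag_real (complexmx_hermitian sX).
exact.
Qed.

Lemma eigvec_spec (R : realType) (n : nat) (X : 'M[R]_n) : X^T = X ->
  eigvec_re X *m X = diag_mx (eigs X) *m eigvec_re X /\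
  eigvec_im X *m X = diag_mx (eigs X) *m eigvec_im X.
Proof.
move=> sX; set V := spectralmx (complexmx X).
have /hermitian_normalmx/orthomx_spectralP XE := complexmx_hermitian sX.
have VX : V *m complexmx X = diag_mx (spectral_diag (complexmx X)) *m V.
  by rewrite [Y in _ *m Y = _]XE !mulmxA mulmxV ?spectral_unit // mul1mx.
rewrite spectral_diag_eigs // in VX.
split; apply/matrixP=> i j; rewrite mul_diag_mx !mxE.
  have /(congr1 (@complex.Re R)) := congr1 (fun M : 'M[R[i]]_n => M i j) VX.
  rewrite mul_diag_mx !mxE Re_sum [in RHS]mulrC ReMreal mulrC => <-.
  by apply: eq_bigr => k _; rewrite !mxE ReMreal.
have /(congr1 (@complex.Im R)) := congr1 (fun M : 'M[R[i]]_n => M i j) VX.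
rewrite mul_diag_mx !mxE Im_sum [in RHS]mulrC ImMreal mulrC => <-.
by apply: eq_bigr => k _; rewrite !mxE ImMreal.
Qed.

Lemma ReMconj (R : realType) (z w : R[i]) :
  complex.Re (z * w^*) = complex.Re z * complex.Re w + complex.Im z * complex.Im w.
Proof. by case: z w => [a b] [c d] /=; rewrite mulrN opprK. Qed.

Lemma eigvec_row_norm (R : realType) (n : nat) (X : 'M[R]_n) (j : 'I_n) :
  \sum_i (eigvec_re X j i ^+ 2 + eigvec_im X j i ^+ 2) = 1.
Proof.
have /unitarymxP := spectral_unitarymx (complexmx X).
move/(congr1 (fun M : 'M[R[i]]_n => complex.Re (M j j))).
rewrite !mxE eqxx /= Re_sum => <-.
by apply: eq_bigr => i _; rewrite !mxE ReMconj !expr2.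
Qed.

(** The real part of V^* V = I for the unitary V. *)
Lemma eigvec_gram (R : realType) (n : nat) (X : 'M[R]_n) :
  (eigvec_re X)^T *m eigvec_re X + (eigvec_im X)^T *m eigvec_im X = 1%:M.
Proof.
set V := spectralmx (complexmx X).
have VV : invmx V *m V = 1%:M by rewrite mulVmx ?spectral_unit.
rewrite invmx_unitary ?spectral_unitarymx // in VV.
apply/matrixP=> i j.
have := congr1 (fun M : 'M[R[i]]_n => complex.Re (M i j)) VV.
rewrite [X in complex.Re X = _]mxE Re_sum => E.
transitivity (complex.Re ((1%:M : 'M[R[i]]_n) i j)); last by rewrite !mxE; case: eqP.
rewrite -E !mxE -big_split /=; apply: eq_bigr => k _.
by rewrite !mxE [_^* * _]mulrC ReMconj [X in X + _]mulrC [X in _ + X]mulrC.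
Qed.

(** The real part of V^* diag(e) V. When e is a function of the eigenvalues of X,
    this is that function of X, without a choice of real eigenbasis. *)
Definition eigcalc (R : realType) (n : nat) (X : 'M[R]_n) (e : 'rV[R]_n) : 'M[R]_n :=
  (eigvec_re X)^T *m diag_mx e *m eigvec_re X
  + (eigvec_im X)^T *m diag_mx e *m eigvec_im X.

Lemma eigcalcB (R : realType) (n : nat) (X : 'M[R]_n) (d e : 'rV[R]_n) :
  eigcalc X (d - e) = eigcalc X d - eigcalc X e.
Proof.
rewrite /eigcalc linearB /= !mulmxBr !mulmxBl opprD.
by rewrite addrACA.
Qed.

Lemma eigcalc_eigs (R : realType) (n : nat) (X : 'M[R]_n) :
  X^T = X -> eigcalc X (eigs X) = X.
Proof.
move=> sX; have [re im] := eigvec_spec sX.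
rewrite /eigcalc -!mulmxA -re -im !mulmxA -mulmxDl eigvec_gram.
exact: mul1mx.
Qed.

Lemma eigcalc_const (R : realType) (n : nat) (X : 'M[R]_n) (a : R) :
  eigcalc X (const_mx a) = a%:M.
Proof.
rewrite /eigcalc diag_const_mx !mul_mx_scalar -!scalemxAl -scalerDr eigvec_gram.
by rewrite scalemx1.
Qed.

Lemma psd_eigcalc (R : realType) (n : nat) (X : 'M[R]_n) (e : 'rV[R]_n) :
  (forall j, 0 <= e 0 j) -> psdmx (eigcalc X e).
Proof. by move=> e0; apply: psdD; apply/psd_congr/psd_diag. Qed.

(** By [eigvec_gram] and [eigvec_row_norm] the weights are doubly stochastic. *)
Lemma eigcalc_diag (R : realType) (n : nat) (X : 'M[R]_n) (e : 'rV[R]_n) i :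
  eigcalc X e i i
  = \sum_j (eigvec_re X j i ^+ 2 + eigvec_im X j i ^+ 2) * e 0 j.
Proof.
rewrite mxE !mul_mx_diag !mxE -big_split; apply: eq_bigr => j _ /=.
by rewrite !mxE; ring.
Qed.

(** Both lists are the roots of the characteristic polynomial. *)
Lemma perm_eq_diag_conj (F : fieldType) (n : nat) (P Q : 'M[F]_n)
    (d e : 'rV[F]_n) :
  P \in unitmx -> Q \in unitmx ->
  invmx P *m diag_mx d *m P = invmx Q *m diag_mx e *m Q ->
  perm_eq [seq d 0 i | i : 'I_n] [seq e 0 i | i : 'I_n].
Proof.
have char_conj (V : 'M[F]_n) (c : 'rV[F]_n) : V \in unitmx ->
    char_poly (invmx V *m diag_mx c *m V)
    = \prod_(x <- [seq c 0 i | i : 'I_n]) ('X - x%:P).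
  move=> uV.
  have VV : (map_mx polyC (invmx V)) *m (map_mx polyC V) = 1%:M.
    by rewrite -map_mxM mulVmx // map_mx1.
  have E : char_poly_mx (invmx V *m diag_mx c *m V)
      = map_mx polyC (invmx V) *m char_poly_mx (diag_mx c) *m map_mx polyC V.
    rewrite /char_poly_mx mulmxBr mulmxBl !map_mxM; congr (_ - _).
    by rewrite mul_mx_scalar -scalemxAl VV scalemx1.
  rewrite /char_poly E !det_mulmx mulrAC -det_mulmx VV det1 mul1r.
  rewrite -/(char_poly _) char_poly_trig ?diag_mx_is_trig //.
  by rewrite big_image /=; apply: eq_bigr => i _; rewrite mxE eqxx.
move=> uP uQ /(congr1 char_poly); rewrite !char_conj //.
exact: prod_XsubC_eq.
Qed.

(** * Eigenvalues and the operator norm *)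

Lemma l2normZ (R : realType) (n : nat) (a : R) (x : 'cV[R]_n) :
  l2norm (a *: x) = `|a| * l2norm x.
Proof.
rewrite /l2norm -sqrtr_sqr -sqrtrM ?sqr_ge0 // mulr_sumr.
by congr Num.sqrt; apply: eq_bigr => i _; rewrite mxE exprMn.
Qed.

(** The supremum defining the operator norm is taken over a bounded set, so it
    is a least upper bound and not a default value. *)
Lemma l2norm_mulmx_bounded (R : realType) (n : nat) (A : 'M[R]_n) :
  has_ubound [set l2norm (A *m x) | x in [set x : 'cV[R]_n | l2norm x <= 1]]%classic.
Proof.
exists (Num.sqrt (\sum_i (\sum_j `|A i j|) ^+ 2)) => _ [x /= x1 <-].
have xj j : `|x j 0| <= 1.
  rewrite -(ler_pXn2r (isT : 0 < 2)%N) ?nnegrE // expr1n real_normK ?num_real //.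
  have : l2norm x ^+ 2 <= 1 by rewrite expr_le1 // sqrtr_ge0.
  rewrite sqr_sqrtr; last by apply: sumr_ge0 => i _; rewrite sqr_ge0.
  apply: le_trans; rewrite (bigD1 j) //= lerDl.
  by apply: sumr_ge0 => i _; rewrite sqr_ge0.
rewrite /l2norm ler_wsqrtr // ler_sum // => i _.
have Ai : `|(A *m x) i 0| <= \sum_j `|A i j|.
  rewrite mxE (le_trans (ler_norm_sum _ _ _)) // ler_sum // => j _.
  by rewrite normrM ler_piMr.
rewrite -[leLHS]real_normK ?num_real // ler_pXn2r ?nnegrE //.
by apply: sumr_ge0.
Qed.

Lemma eigenvalue_le_opnorm (R : realType) (n : nat) (A : 'M[R]_n) (d : R)
    (x : 'cV[R]_n) :
  A *m x = d *: x -> x != 0 -> d <= opnorm A.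
Proof.
move=> Ax x0.
have nx0 : 0 < l2norm x.
  rewrite sqrtr_gt0 lt0r sumr_ge0 ?andbT => [|i _]; last exact: sqr_ge0.
  apply: contraNneq x0 => /eqP; rewrite psumr_eq0 => [/allP xi|i _]; last exact: sqr_ge0.
  apply/eqP/colP => i; rewrite mxE.
  by have := xi i (mem_index_enum i); rewrite sqrf_eq0 => /eqP.
apply: le_trans (ler_norm d) _.
apply: ub_le_sup; first exact: l2norm_mulmx_bounded.
have ny : l2norm ((l2norm x)^-1 *: x) = 1.
  by rewrite l2normZ gtr0_norm ?invr_gt0 // mulVf // gt_eqF.
exists ((l2norm x)^-1 *: x); first by rewrite /= ny.
by rewrite -scalemxAr Ax scalerA mulrC -scalerA l2normZ ny mulr1.
Qed.

Lemma eigs_le_opnorm (R : realType) (n : nat) (A : 'M[R]_n) (j : 'I_n) :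
  A^T = A -> eigs A 0 j <= opnorm A.
Proof.
move=> sA; have [re im] := eigvec_spec sA.
have ev (V : 'M[R]_n) : V *m A = diag_mx (eigs A) *m V ->
    A *m (row j V)^T = eigs A 0 j *: (row j V)^T.
  move=> VA; rewrite -[in LHS]sA -trmx_mul -row_mul VA -linearZ; congr trmx.
  by apply/rowP=> i; rewrite mul_diag_mx !mxE.
have [re0|] := eqVneq (row j (eigvec_re A))^T 0; last first.
  exact/eigenvalue_le_opnorm/ev.
have [im0|] := eqVneq (row j (eigvec_im A))^T 0; last first.
  exact/eigenvalue_le_opnorm/ev.
have := eigvec_row_norm A j; rewrite big1 => [/eqP|i _].
  by rewrite eq_sym oner_eq0.
have row0 (V : 'M[R]_n) : (row j V)^T = 0 -> V j i = 0.
  by move=> /colP/(_ i); rewrite !mxE.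
by rewrite !row0 // expr0n addr0.
Qed.

(** * Quadratic forms along the eigenvectors *)

(** The value of the form of M at the j-th complex eigenvector of X, written with
    its real and imaginary parts. *)
Definition eigform (R : realType) (n : nat) (X M : 'M[R]_n) (j : 'I_n) : R :=
  (eigvec_re X *m M *m (eigvec_re X)^T + eigvec_im X *m M *m (eigvec_im X)^T) j j.

Lemma eigformD (R : realType) (n : nat) (X M N : 'M[R]_n) j :
  eigform X (M + N) j = eigform X M j + eigform X N j.
Proof.
by rewrite /eigform !mulmxDr !mulmxDl addrACA mxE.
Qed.

Lemma eigform_ge0 (R : realType) (n : nat) (X M : 'M[R]_n) j :
  psdmx M -> 0 <= eigform X M j.
Proof.
move=> pM; apply: psd_diag_ge0; apply: psdD.
  by rewrite -{1}[eigvec_re X]trmxK; apply: psd_congr.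
by rewrite -{1}[eigvec_im X]trmxK; apply: psd_congr.
Qed.

Lemma eigform_diag (R : realType) (n : nat) (X : 'M[R]_n) (d : 'rV[R]_n) M j :
  eigvec_re X *m M = diag_mx d *m eigvec_re X ->
  eigvec_im X *m M = diag_mx d *m eigvec_im X ->
  eigform X M j = d 0 j.
Proof.
move=> re im; rewrite /eigform re im -!mulmxA -mulmxDr mul_diag_mx mxE.
rewrite -[RHS]mulr1 -(eigvec_row_norm X j) big_split mxE; congr (_ * _).
by rewrite !mxE; congr (_ + _); apply: eq_bigr => i _; rewrite !mxE.
Qed.

Lemma eigform_eigs (R : realType) (n : nat) (X : 'M[R]_n) j :
  X^T = X -> eigform X X j = eigs X 0 j.
Proof. by move=> /eigvec_spec[re im]; exact: eigform_diag. Qed.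

Lemma eigform_scalar (R : realType) (n : nat) (X : 'M[R]_n) (r : R) j :
  eigform X r%:M j = r.
Proof.
rewrite (@eigform_diag _ _ X (const_mx r)) ?mxE //.
  by rewrite diag_const_mx scalar_mxC.
by rewrite diag_const_mx scalar_mxC.
Qed.

(** The eigenvectors resolve the identity, so the trace is the sum of the values of
    the form along them. *)
Lemma sum_eigform (R : realType) (n : nat) (X M : 'M[R]_n) :
  \sum_j eigform X M j = \tr M.
Proof.
rewrite -[LHS]/(\tr _) linearD /= ![\tr (_ *m M *m _)]mxtrace_mulC.
by rewrite !mulmxA -linearD /= -mulmxDl eigvec_gram mul1mx.
Qed.

Lemma eigs_ge0 (R : realType) (n : nat) (X : 'M[R]_n) j :
  psdmx X -> 0 <= eigs X 0 j.
Proof. by move=> pX; rewrite -eigform_eigs ?pX.1 //; exact: eigform_ge0. Qed.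

(** * Sums of the largest entries and Ky Fan's inequality *)

Lemma decr_perm (R : realType) (n : nat) (a : 'rV[R]_n) :
  perm_eq (decr_rearrangement a) [seq a 0 i | i : 'I_n].
Proof. by rewrite perm_sort. Qed.

Lemma decr_size (R : realType) (n : nat) (a : 'rV[R]_n) :
  size (decr_rearrangement a) = n.
Proof. by rewrite (perm_size (decr_perm a)) size_image card_ord. Qed.

Lemma decr_sorted (R : realType) (n : nat) (a : 'rV[R]_n) :
  sorted >=%R (decr_rearrangement a).
Proof. exact: sort_sorted ge_total _. Qed.

Lemma decr_uniq (R : realType) (n : nat) (a : 'rV[R]_n) (s : seq R) :
  sorted >=%R s -> perm_eq s [seq a 0 i | i : 'I_n] -> decr_rearrangement a = s.
Proof.
move=> ss ps; apply: (sorted_eq ge_trans ge_anti) => //; first exact: decr_sorted.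
by apply: perm_trans (decr_perm a) _; rewrite perm_sym.
Qed.

(** [eigval] is sorted already, so the second sorting in the definition of weak
    majorization does nothing. *)
Lemma decr_eigval (R : realType) (n : nat) (X : 'M[R[i]]_n) :
  decr_rearrangement (eigval X)
  = decr_rearrangement (map_mx (@complex.Re R) (spectral_diag X)).
Proof.
apply: decr_uniq; first exact: decr_sorted.
rewrite /eigval; set s := decr_rearrangement _.
suff -> : [seq (\row_i0 s`_i0) 0 i | i : 'I_n] = s by [].
rewrite -[RHS](mkseq_nth 0) decr_size /mkseq -val_enum_ord -map_comp.
by apply: eq_map => i /=; rewrite mxE.
Qed.

Lemma sum_decr (R : realType) (n : nat) (a : 'rV[R]_n) (F : R -> R) :
  \sum_i F (a 0 i) = \sum_(i < n) F (decr_rearrangement a)`_i.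
Proof.
transitivity (\sum_(x <- [seq a 0 i | i : 'I_n]) F x); first by rewrite big_image.
rewrite -(perm_big _ (decr_perm a)) (big_nth 0) big_mkord decr_size //.
Qed.

Lemma decr_nth_ge (R : realType) (n : nat) (a : 'rV[R]_n) (i j : nat) :
  (i <= j < n)%N -> (decr_rearrangement a)`_j <= (decr_rearrangement a)`_i.
Proof.
move=> /andP[ij jn].
apply: (sorted_leq_nth ge_trans lexx 0 (decr_sorted a)) => //.
  by rewrite inE decr_size (leq_ltn_trans ij).
by rewrite inE decr_size.
Qed.

(** Every entry above r exceeds it by at most the corresponding z, so the k largest
    entries together exceed k r by at most the total of z. *)
Lemma top_sum_le (R : realType) (n : nat) (a : 'rV[R]_n) (z : 'I_n -> R)
    (r : R) (k : nat) :
  (k <= n)%N -> (forall i, 0 <= z i) -> (forall i, a 0 i <= r + z i) ->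
  \sum_(i < k) (decr_rearrangement a)`_i <= r *+ k + \sum_i z i.
Proof.
move=> kn z0 az; pose s := decr_rearrangement a.
have -> : r *+ k = \sum_(i < k) r by rewrite sumr_const card_ord.
rewrite -lerBlDl -sumrB.
apply: (@le_trans _ _ (\sum_i Num.max (a 0 i - r) 0)); last first.
  by apply: ler_sum => i _; rewrite ge_max z0 lerBlDl az.
rewrite (sum_decr a (fun x => Num.max (x - r) 0)) -/s.
rewrite (big_ord_widen n (fun i => s`_i - r)) //.
rewrite [leRHS](bigID (fun i : 'I_n => (i < k)%N)) /=.
rewrite ler_wpDr //; first by apply: sumr_ge0 => i _; rewrite le_max lexx orbT.
by apply: ler_sum => i _; rewrite le_max lexx.
Qed.

(** Entries after the k-th in decreasing order lie below the threshold t and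
    contribute nothing; the first k lie above it and contribute g(a_i) - g(t). *)
Lemma sum_above_threshold (R : realType) (n : nat) (a : 'rV[R]_n) (g : R -> R)
    (k : nat) :
  (0 < k <= n)%N -> let t := (decr_rearrangement a)`_k.-1 in
  g t *+ k + \sum_i (g (Num.max (a 0 i) t) - g t)
  = \sum_(i < k) g (decr_rearrangement a)`_i.
Proof.
move=> /andP[k0 kn] t; set s := decr_rearrangement a in t *.
rewrite (sum_decr a (fun x => g (Num.max x t) - g t)) -/s.
rewrite (bigID (fun i : 'I_n => (i < k)%N)) /= [X in _ + (_ + X)]big1 => [|i ik].
  have -> : g t *+ k = \sum_(i < k) g t by rewrite sumr_const card_ord.
  rewrite addr0 -(big_ord_widen n (fun i => g (Num.max s`_i t) - g t)) //.
  rewrite -big_split /=; apply: eq_bigr => i _.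
  rewrite max_l ?subrKC //; apply: decr_nth_ge.
  by rewrite -ltnS prednK // ltn_ord.
rewrite max_r ?subrr //; apply: decr_nth_ge.
by rewrite ltn_ord andbT (leq_trans (leq_pred k)) // leqNgt.
Qed.

Lemma decr_map (R : realType) (n : nat) (a : 'rV[R]_n) (g : R -> R) :
  (forall i j, a 0 i <= a 0 j -> g (a 0 i) <= g (a 0 j)) ->
  decr_rearrangement (map_mx g a) = map g (decr_rearrangement a).
Proof.
move=> gm; apply: decr_uniq; last first.
  have -> : [seq (map_mx g a) 0 i | i : 'I_n] = map g [seq a 0 i | i : 'I_n].
    by rewrite -map_comp; apply: eq_map => i; rewrite /= mxE.
  exact/perm_map/decr_perm.
have aP := decr_sorted a.
apply: (homo_sorted_in (P := [in [seq a 0 i | i : 'I_n]]) _ _ aP).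
  move=> x y /mapP[i _ ->] /mapP[j _ ->] /=; exact: gm.
by apply/allP => x; rewrite (perm_mem (decr_perm a)).
Qed.

(** Along each unit eigenvector of X the form of Y is at most r, hence each
    eigenvalue of X is at most r plus the form of Z there, and the forms of Z add
    up to its trace. *)
Lemma ky_fan_le (R : realType) (n : nat) (X Y Z : 'M[R]_n) (r : R) (k : nat) :
  X^T = X -> X = Y + Z -> psdmx (r%:M - Y) -> psdmx Z -> (k <= n)%N ->
  \sum_(i < k) (decr_rearrangement (eigval (complexmx X)))`_i <= r *+ k + \tr Z.
Proof.
move=> sX XE prY pZ kn; rewrite decr_eigval -(sum_eigform X Z).
apply: top_sum_le => // i; first exact: eigform_ge0.
rewrite -/(eigs X) -eigform_eigs // [X in eigform _ X]XE eigformD lerD2r.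
have := eigform_scalar X r i; rewrite -{1}[r%:M](subrK Y) eigformD => <-.
by rewrite lerDr; exact: eigform_ge0.
Qed.

(** * The majorization *)

(** The diagonalization of X also diagonalizes f(X) - b I; comparing it with the
    chosen diagonalization of f(X) - b I gives the same list of eigenvalues up to
    order. *)
Lemma decr_eigval_funcalc (R : realType) (n : nat) (X : 'M[R]_n) (f : R -> R)
    (b : R) :
  X^T = X ->
  decr_rearrangement (eigval (funcalc f (complexmx X) - complexmx b%:M))
  = decr_rearrangement (map_mx (fun x => f x - b) (eigs X)).
Proof.
move=> sX; set V := spectralmx (complexmx X).
set e := map_mx (fun x => f x - b) (eigs X).
set M := _ - _.
have uV : V \in unitmx by exact: spectral_unit.
have ME : M = invmx V *m diag_mx (map_mx (real_complex R) e) *m V.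
  rewrite /M /funcalc -/V.
  have -> : complexmx b%:M = invmx V *m diag_mx (const_mx (b%:C)%C) *m V.
    rewrite diag_const_mx mul_mx_scalar -scalemxAl mulVmx // scalemx1.
    by rewrite /complexmx map_scalar_mx.
  rewrite -mulmxBl -mulmxBr -linearB /=; congr (_ *m diag_mx _ *m _).
  by apply/rowP=> j; rewrite !mxE rmorphB.
have /orthomx_spectralP ME' : M \is normalmx.
  by apply/orthomx_spectral_subproof; exists (V, map_mx (real_complex R) e) => //;
     exact: spectral_unitarymx.
rewrite decr_eigval; apply: decr_uniq; first exact: decr_sorted.
apply: perm_trans (decr_perm _) _.
have := perm_eq_diag_conj (spectral_unit M) uV (etrans (esym ME') ME).
move=> /(perm_map (@complex.Re R)).
have ReE (c : 'rV[R[i]]_n) : [seq complex.Re z | z <- [seq c 0 i | i : 'I_n]]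
    = [seq (map_mx (@complex.Re R) c) 0 i | i : 'I_n].
  by rewrite -map_comp; apply: eq_map => i; rewrite /= mxE.
have ReK : map_mx (@complex.Re R) (map_mx (real_complex R) e) = e.
  by apply/rowP=> j; rewrite mxE mxE.
by rewrite !ReE ReK perm_sym.
Qed.

(** [S_mono_jensen_incr] on each diagonal entry; in the sum over the entries the
    weights of each eigenvalue add up to 1. *)
Lemma S_mono_trace_incr (R : realType) (alpha : \bar R) (n : nat) (f : R -> R)
    (A : 'M[R]_n) (t : R) (C := eigcalc A (map_mx (Num.min^~ t) (eigs A))) :
  (2 <= n)%N -> S_mono n alpha f -> psdmx A ->
  0 <= t -> (t%:E < alpha)%E -> (forall j, ((eigs A 0 j)%:E < alpha)%E) ->
  \tr (map_mx f A - map_mx f C) <= \sum_j (f (Num.max (eigs A 0 j) t) - f t).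
Proof.
move=> hn hf hA t0 ta da; have sA := hA.1.
pose d := eigs A; have d0 j : 0 <= d 0 j by exact: eigs_ge0.
rewrite -/d.
pose w i j := eigvec_re A j i ^+ 2 + eigvec_im A j i ^+ 2.
have w0 i j : 0 <= w i j by rewrite addr_ge0 ?sqr_ge0.
have w1 i : \sum_j w i j = 1.
  have := eigcalc_diag A (const_mx 1) i; rewrite eigcalc_const mxE eqxx => E.
  rewrite -[RHS]/(1%:R) [RHS]E.
  by apply: eq_bigr => j _; rewrite [X in _ * X]mxE mulr1.
apply: (@le_trans _ _ (\sum_i \sum_j w i j * (f (Num.max (d 0 j) t) - f t))).
  have AE i : A i i = \sum_j w i j * d 0 j.
    by rewrite -[in LHS](eigcalc_eigs sA) eigcalc_diag.
  have CE i : C i i = \sum_j w i j * Num.min (d 0 j) t.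
    by rewrite eigcalc_diag; apply: eq_bigr => j _; rewrite [X in _ * X]mxE.
  apply: ler_sum => i _.
  have -> : (map_mx f A - map_mx f C) i i = f (A i i) - f (C i i).
    by move: (C) => M; rewrite !mxE.
  by rewrite AE CE; apply: (S_mono_jensen_incr hn hf).
rewrite exchange_big /=; apply: ler_sum => j _.
by rewrite -mulr_suml eigvec_row_norm mul1r.
Qed.

Theorem theorem6p1 (R : realType) (alpha : \bar R) (halpha : (0 < alpha)%E)
    (n : nat) (hn : (2 <= n)%N) (f : R -> R) (hf : S_mono n alpha f)
    (A : 'M[R]_n) (hA : psdmx A) (hnorm : ((opnorm A)%:E < alpha)%E) :
  weak_major
    (eigval (complexmx (map_mx f A - f 0 *: const_mx 1)))
    (eigval (funcalc f (complexmx A) - complexmx (f 0)%:M)).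
Proof.
move=> k /[dup] kn /andP[k0 kn'].
have sA := hA.1.
pose d := eigs A; pose t := (decr_rearrangement d)`_k.-1.
have d0 j : 0 <= d 0 j by exact: eigs_ge0.
have da j : ((d 0 j)%:E < alpha)%E.
  exact: lte_fin_trans (eigs_le_opnorm j sA) hnorm.
have [t0 ta] : 0 <= t /\ (t%:E < alpha)%E.
  have : t \in decr_rearrangement d by rewrite mem_nth // decr_size prednK.
  by rewrite (perm_mem (decr_perm d)) => /mapP[j _ ->].
pose C := eigcalc A (map_mx (Num.min^~ t) d).
have pC : psdmx C by apply: psd_eigcalc => j; rewrite mxE le_min d0.
have pAC : psdmx (A - C).
  rewrite -{1}(eigcalc_eigs sA) -eigcalcB; apply: psd_eigcalc => j.
  by rewrite !mxE subr_ge0 ge_min lexx.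
have ptC : psdmx (t%:M - C).
  rewrite -(eigcalc_const A) -eigcalcB; apply: psd_eigcalc => j.
  by rewrite !mxE subr_ge0 ge_min lexx orbT.
have pT : psdmx (t%:M : 'M[R]_n).
  by rewrite -(eigcalc_const A); apply: psd_eigcalc => j; rewrite mxE.
have eC : entries_in alpha C.
  by move=> i j; apply: in_sym_itvP ta; exact: psd_entry_le.
have eT : entries_in alpha (t%:M : 'M[R]_n).
  by move=> i j; apply: in_sym_itvP ta; apply: psd_entry_le; rewrite // subrr;
     split=> [|x]; rewrite ?trmx0 // mulmx0 mul0mx mxE.
have eA : entries_in alpha A.
  have := fun l => eigs_le_opnorm l sA; move: (opnorm A) hnorm => r ra dr i j.
  apply: in_sym_itvP ra; apply: psd_entry_le => //.
  rewrite -{1}(eigcalc_eigs sA) -(eigcalc_const A) -eigcalcB.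
  by apply: psd_eigcalc => l; rewrite mxE mxE mxE subr_ge0.
have pfAC : psdmx (map_mx f A - map_mx f C) by apply: hf => //; [exact: pC.1].
have pftC : psdmx (map_mx f t%:M - map_mx f C).
  by apply: hf => //; [exact: pT.1|exact: pC.1].
have trle := S_mono_trace_incr hn hf hA t0 ta da.
have lhs : \sum_(i < k) (decr_rearrangement
      (eigval (complexmx (map_mx f A - f 0 *: const_mx 1))))`_i
    <= (f t - f 0) *+ k + \tr (map_mx f A - map_mx f C).
  apply: (@ky_fan_le _ _ _ (map_mx f C - f 0 *: const_mx 1)) => //.
  - apply/matrixP=> i j; rewrite !mxE.
    by rewrite -{1}sA mxE.
  - by apply/matrixP=> i j; rewrite !mxE; ring.
  - suff -> : (f t - f 0)%:M - (map_mx f C - f 0 *: const_mx 1)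
        = map_mx f t%:M - map_mx f C by [].
    apply/matrixP=> i j; rewrite !mxE; case: eqP => _; rewrite ?mulr1n ?mulr0n; ring.
apply: le_trans lhs _; rewrite decr_eigval_funcalc // decr_map => [|i j]; last first.
  by move=> dij; rewrite lerD2r; apply: (S_mono_nondecreasing hn hf).
apply: (@le_trans _ _ ((f t - f 0) *+ k
   + \sum_j ((f (Num.max (d 0 j) t) - f 0) - (f t - f 0)))).
  rewrite lerD2l; apply: le_trans trle _; apply: ler_sum => j _; lra.
rewrite (@sum_above_threshold _ _ d (fun x => f x - f 0) k kn).
rewrite le_eqVlt; apply/orP; left; apply/eqP; apply: eq_bigr => i _.
by rewrite (nth_map 0) // decr_size (leq_trans (ltn_ord i)).
Qed.
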